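(* Consider the strengthened equality-constrained mixed-binary quadratic program $$v^{P_1}:=\min\{x^\top Qx+2c^\top x:\ Ax=b,\ x_B\le e,\ x_B\in\{0,1\}^p,\ x\in\mathbb{R}^n_+\},$$ and let $v^{P_2}$ and $v^{P_3}$ be the optimal values of its slack and complementarity reformulations, and $v^{\mathrm{SHOR}}$, $v^{\text{SDP-RLT}}$, $v^{\mathrm{DNN}}$, $v^{\mathrm{COMP}}$ the optimal values of its Shor, SDP-RLT, DNN and complementarity relaxations (all defined in the context). Then $$v^{\mathrm{SHOR}}\le v^{\text{SDP-RLT}}=v^{\mathrm{DNN}}=v^{\mathrm{COMP}}\le v^{P_1}=v^{P_2}=v^{P_3}.$$
   Context: Data: $Q\in\mathbb{S}^n$ (real symmetric $n\times n$ matrices), $c\in\mathbb{R}^n$, $A\in\mathbb{R}^{m\times n}$, $b\in\mathbb{R}^m$, $B=\{i_1<\dots<i_p\}\subseteq[n]$. Standing assumption: $A$ has full row rank and $b\ge0$. $e$ is the all-ones vector (here in $\mathbb{R}^p$), $x_B=(x_i)_{i\in B}$, and $E_B\in\mathbb{R}^{p\times n}$ is the selection matrix with $E_Bx=x_B$. All inequalities between vectors or matrices are entrywise. $\mathbb{S}^k_+$ is the cone of positive semidefinite matrices in $\mathbb{S}^k$; $\mathbb{N}^k$ is the cone of entrywise nonnegative $k\times k$ real matrices; $\langle U,V\rangle=\mathrm{Tr}(UV^\top)$; $\operatorname{diag}_B(X)=(X_{ii})_{i\in B}$; $\circ$ is the entrywise product. ''min'' denotes the optimal value, i.e. the infimum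 in $[-\infty,+\infty]$, with value $+\infty$ if the feasible set is empty. Reformulations: $v^{P_2}:=\min\{x^\top Qx+2c^\top x:\ Ax=b,\ x_B+s=e,\ x_B\in\{0,1\}^p,\ x\in\mathbb{R}^n_+,\ s\in\mathbb{R}^p_+\}$; $v^{P_3}:=\min\{x^\top Qx+2c^\top x:\ Ax=b,\ x_B+s=e,\ x_B\circ s=0,\ x\in\mathbb{R}^n_+,\ s\in\mathbb{R}^p_+\}$. Write $Y=\begin{bmatrix} z & x^\top \\ x & X \end{bmatrix}\in\mathbb{S}^{n+1}$ with $z\in\mathbb{R}$, $x\in\mathbb{R}^n$, $X\in\mathbb{S}^n$, and put $C=\begin{bmatrix} 0 & c^\top \\ c & Q \end{bmatrix}$. Put $G=E_B$ and $d=e\in\mathbb{R}^p$ (so that $x_B\le e$ is the constraint $Gx\le d$). Shor relaxation: $v^{\mathrm{SHOR}}:=\min\{\langle C,Y\rangle:\ Y\in\mathbb{S}^{n+1}_+,\ Ax=b,\ x_i=X_{ii}\ \forall i\in B,\ z=1,\ zd-Gx\ge0,\ x\ge0\}$. SDP-RLT relaxation: $v^{\text{SDP-RLT}}:=\min\{\langle C,Y\rangle:\ Y\in\mathbb{S}^{n+1}_+\cap\mathbb{N}^{n+1},\ Ax=b,\ AX=bx^\top,\ x_i=X_{ii}\ \forall i\in B,\ z=1,\ \mathcal G(Y)\ge0,\ dx^\top-GX\ge0,\ zd-Gx\ge0\}$, where $\mathcal G(Y)=GXG^\top-Gxd^\top-dx^\top G^\top+zdd^\top$. For the remaining two relaxations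 let $Q'=\begin{bmatrix} Q & 0_{n\times p} \\ 0_{p\times n} & 0_{p\times p} \end{bmatrix}$, $A'=\begin{bmatrix} A & 0_{m\times p} \\ G & I_p \end{bmatrix}$, $c'=\begin{bmatrix} c \\ 0_{p\times 1} \end{bmatrix}$, $b'=\begin{bmatrix} b \\ d \end{bmatrix}$, $C'=\begin{bmatrix} 0 & (c')^\top \\ c' & Q' \end{bmatrix}$, and write $Y'=\begin{bmatrix} z' & (x')^\top \\ x' & X' \end{bmatrix}\in\mathbb{S}^{n+p+1}$ with $z'\in\mathbb{R}$, $x'\in\mathbb{R}^{n+p}$, $X'\in\mathbb{S}^{n+p}$. DNN relaxation: $v^{\mathrm{DNN}}:=\min\{\langle C',Y'\rangle:\ Y'\in\mathbb{S}^{n+p+1}_+\cap\mathbb{N}^{n+p+1},\ A'x'=b',\ A'X'=b'(x')^\top,\ \operatorname{diag}_B(X')=x'_B,\ z'=1\}$. Complementarity relaxation: $v^{\mathrm{COMP}}:=\min\{\langle C',Y'\rangle:\ Y'\in\mathbb{S}^{n+p+1}_+\cap\mathbb{N}^{n+p+1},\ A'x'=b',\ A'X'=b'(x')^\top,\ z'=1,\ X'_{i_k,\,n+k}=0\ \text{for } k=1,\dots,p\}$. *)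

(* Defs.v *)
From HB Require Import structures.
From mathcomp Require Import all_boot all_order all_algebra.
From mathcomp Require Import classical_sets reals constructive_ereal ereal.

Set Implicit Arguments.
Unset Strict Implicit.
Unset Printing Implicit Defensive.

Import Order.TTheory GRing.Theory Num.Theory.
Local Open Scope classical_set_scope.
Local Open Scope ring_scope.

(* Vectors are column vectors. *)

(* Entrywise order. *)
Definition lemx (R : realType) (m n : nat) (U V : 'M[R]_(m, n)) : Prop :=
  forall i j, U i j <= V i j.

Definition psdmx (R : realType) (k : nat) (Y : 'M[R]_k) : Prop :=
  Y \is symmetricmx /\ forall v : 'cV[R]_k, 0 <= (v^T *m Y *m v) 0 0.

Definition mxinner (R : realType) (m n : nat) (U V : 'M[R]_(m, n)) : R :=
  \tr (U *m V^T).

(* The optimal value "min" is an infimum in [-oo, +oo], not assumed attained;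
   it is +oo when the feasible set is empty. *)
Definition optval (R : realType) (T : Type) (feas : set T) (obj : T -> R) :
  \bar R := ereal_inf [set (obj y)%:E | y in feas].

Definition qobj (R : realType) (n : nat) (Q : 'M[R]_n) (c : 'cV[R]_n)
  (x : 'cV[R]_n) : R := (x^T *m Q *m x) 0 0 + 2 * (c^T *m x) 0 0.

(* For B = {i_1 < ... < i_p}, p is #|B| and i_k is [enum_val k], since
   enumerations of subsets of 'I_n are increasing. *)
Definition selmx (R : realType) (n : nat) (B : {set 'I_n}) : 'M[R]_(#|B|, n) :=
  \matrix_(k < #|B|, j < n) (enum_val k == j)%:R.

Definition onesv (R : realType) (p : nat) : 'cV[R]_p := const_mx 1.

Section Blocks.
Variables (R : realType) (k : nat) (Y : 'M[R]_(1 + k)).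

(* Y = [z x^T; x X]. For symmetric Y the upper right block is x^T. *)
Definition zpart : R := ulsubmx Y 0 0.
Definition xpart : 'cV[R]_k := dlsubmx Y.
Definition Xpart : 'M[R]_k := drsubmx Y.

End Blocks.

Definition costmx (R : realType) (k : nat) (Q : 'M[R]_k) (c : 'cV[R]_k) :
  'M[R]_(1 + k) := block_mx 0 c^T c Q.

Section Programs.
Variables (R : realType) (m n : nat).
Variables (Q : 'M[R]_n) (c : 'cV[R]_n) (A : 'M[R]_(m, n)) (b : 'cV[R]_m).
Variable B : {set 'I_n}.

Local Notation p := #|B|.
Local Notation G := (selmx R B).
Local Notation d := (onesv R p).

Definition binaryB (x : 'cV[R]_n) : Prop :=
  forall k, (G *m x) k 0 = 0 \/ (G *m x) k 0 = 1.

Definition feasP1 : set 'cV[R]_n := [set x |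
  [/\ A *m x = b, lemx (G *m x) d, binaryB x & lemx 0 x]].

Definition feasP2 : set ('cV[R]_n * 'cV[R]_p) := [set xs |
  [/\ A *m xs.1 = b, G *m xs.1 + xs.2 = d, binaryB xs.1,
      lemx 0 xs.1 & lemx 0 xs.2]].

Definition feasP3 : set ('cV[R]_n * 'cV[R]_p) := [set xs |
  [/\ A *m xs.1 = b, G *m xs.1 + xs.2 = d,
      map2_mx *%R (G *m xs.1) xs.2 = 0,
      lemx 0 xs.1 & lemx 0 xs.2]].

Definition vP1 : \bar R := optval feasP1 (qobj Q c).
Definition vP2 : \bar R := optval feasP2 (fun xs => qobj Q c xs.1).
Definition vP3 : \bar R := optval feasP3 (fun xs => qobj Q c xs.1).

Definition feasSHOR : set 'M[R]_(1 + n) := [set Y |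
  let z := zpart Y in let x := xpart Y in let X := Xpart Y in
  psdmx Y /\
  [/\ A *m x = b, (forall i, i \in B -> x i 0 = X i i), z = 1,
      lemx 0 (z *: d - G *m x) & lemx 0 x]].

Definition vSHOR : \bar R := optval feasSHOR (mxinner (costmx Q c)).

Definition GRLT (Y : 'M[R]_(1 + n)) : 'M[R]_p :=
  let z := zpart Y in let x := xpart Y in let X := Xpart Y in
  G *m X *m G^T - G *m x *m d^T - d *m x^T *m G^T + z *: (d *m d^T).

Definition feasSDPRLT : set 'M[R]_(1 + n) := [set Y |
  let z := zpart Y in let x := xpart Y in let X := Xpart Y in
  [/\ psdmx Y, lemx 0 Y, A *m x = b & A *m X = b *m x^T] /\
  [/\ (forall i, i \in B -> x i 0 = X i i), z = 1, lemx 0 (GRLT Y),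
      lemx 0 (d *m x^T - G *m X) & lemx 0 (z *: d - G *m x)]].

Definition vSDPRLT : \bar R := optval feasSDPRLT (mxinner (costmx Q c)).

Definition liftQ : 'M[R]_(n + p) := block_mx Q 0 0 0.
Definition liftA : 'M[R]_(m + p, n + p) := block_mx A 0 G 1%:M.
Definition liftc : 'cV[R]_(n + p) := col_mx c 0.
Definition liftb : 'cV[R]_(m + p) := col_mx b d.

Definition feasDNN : set 'M[R]_(1 + (n + p)) := [set Y |
  let z := zpart Y in let x := xpart Y in let X := Xpart Y in
  [/\ psdmx Y, lemx 0 Y, liftA *m x = liftb & liftA *m X = liftb *m x^T] /\
  (forall i, i \in B -> X (lshift p i) (lshift p i) = x (lshift p i) 0) /\
  z = 1].

Definition vDNN : \bar R := optval feasDNN (mxinner (costmx liftQ liftc)).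

Definition feasCOMP : set 'M[R]_(1 + (n + p)) := [set Y |
  let z := zpart Y in let x := xpart Y in let X := Xpart Y in
  [/\ psdmx Y, lemx 0 Y, liftA *m x = liftb & liftA *m X = liftb *m x^T] /\
  z = 1 /\
  (forall k : 'I_p, X (lshift p (enum_val k)) (rshift n k) = 0)].

Definition vCOMP : \bar R := optval feasCOMP (mxinner (costmx liftQ liftc)).

End Programs.

(* Main.v *)
(* Writing s = d - G x for the slack, the equations A' x' = b' and
   A' X' = b' x'^T determine every block of Y' from the leading block
   [1 x^T; x X]: x' = (x, s), and the blocks of X' are X, x d^T - X G^T, its
   transpose, and the RLT matrix. Hence Y' is nonnegative exactly when the RLT
   inequalities hold, and Y' is a congruence transform L Y L^T of Y, so it is
   positive semidefinite exactly when Y is. The entry of X' at (i_k, n + k) is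
   x_{i_k} - X_{i_k i_k}, so the diagonal and complementarity conditions agree.
   A feasible binary x gives the rank-one matrix (1, x) (1, x)^T. *)
Require Import Defs.
From HB Require Import structures.
From mathcomp Require Import all_boot all_order all_algebra.
From mathcomp Require Import classical_sets reals constructive_ereal ereal.
From mathcomp Require Import ring.

Set Implicit Arguments.
Unset Strict Implicit.
Unset Printing Implicit Defensive.

Import Order.TTheory GRing.Theory Num.Theory.
Local Open Scope ring_scope.

(** Every comparison of optimal values is reduced to a map of feasible points that preserves the
    objective. As the values are infima in the extended reals, neither attainment nor feasibility is
    required. *)
Lemma optval_le (R : realType) (T U : Type) (F : set T) (F' : set U)
    (f : T -> R) (g : U -> R) :
  (forall u, F' u -> exists2 t, F t & f t = g u) ->
  (optval F f <= optval F' g)%E.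
Proof.
move=> H; apply: le_ereal_inf_tmp => _ [u F'u <-].
by have [t Ft <-] := H u F'u; apply: ereal_inf_lbound; exists t.
Qed.

(** * Entrywise nonnegativity and semidefiniteness *)

Lemma lemx0P (R : realType) (m n : nat) (U : 'M[R]_(m, n)) :
  lemx 0 U <-> forall i j, 0 <= U i j.
Proof. by split=> H i j; move: (H i j); rewrite mxE. Qed.

Lemma lemx0_block (R : realType) (m1 m2 n1 n2 : nat) (U : 'M[R]_(m1, n1))
    (V : 'M_(m1, n2)) (W : 'M_(m2, n1)) (Z : 'M_(m2, n2)) :
  lemx 0 (block_mx U V W Z) <->
  [/\ lemx 0 U, lemx 0 V, lemx 0 W & lemx 0 Z].
Proof.
split=> [/lemx0P H | [/lemx0P hU /lemx0P hV /lemx0P hW /lemx0P hZ]].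
  split; apply/lemx0P => i j.
  - by move: (H (lshift m2 i) (lshift n2 j)); rewrite block_mxEul.
  - by move: (H (lshift m2 i) (rshift n1 j)); rewrite block_mxEur.
  - by move: (H (rshift m1 i) (lshift n2 j)); rewrite block_mxEdl.
  - by move: (H (rshift m1 i) (rshift n1 j)); rewrite block_mxEdr.
apply/lemx0P => i j; case: (split_ordP i) => {}i ->;
  case: (split_ordP j) => {}j ->.
- by rewrite block_mxEul.
- by rewrite block_mxEur.
- by rewrite block_mxEdl.
- by rewrite block_mxEdr.
Qed.

Lemma lemx0_tr (R : realType) (m n : nat) (U : 'M[R]_(m, n)) :
  lemx 0 U -> lemx 0 U^T.
Proof. by move=> /lemx0P H; apply/lemx0P => i j; rewrite mxE. Qed.

Lemma symmetricmxP (R : realType) (k : nat) (Y : 'M[R]_k) :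
  Y \is symmetricmx <-> Y^T = Y.
Proof.
rewrite is_hermitianmxE expr0 scale1r map_mx_id //.
by split=> [/eqP <- | ->].
Qed.

Lemma psdmx_congr (R : realType) (k l : nat) (L : 'M[R]_(l, k)) (Y : 'M[R]_k) :
  psdmx Y -> psdmx (L *m Y *m L^T).
Proof.
move=> [/symmetricmxP symY posY]; split.
  by apply/symmetricmxP; rewrite !trmx_mul trmxK symY mulmxA.
by move=> v; move: (posY (L^T *m v)); rewrite trmx_mul trmxK !mulmxA.
Qed.

(** * Homogenized matrices with corner entry 1 *)

Definition hom_mx (R : realType) (k : nat) (x : 'cV[R]_k) (X : 'M[R]_k) :
  'M[R]_(1 + k) := block_mx 1%:M x^T x X.

Section HomMx.
Variables (R : realType) (k : nat).
Implicit Types (x : 'cV[R]_k) (X : 'M[R]_k).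

Lemma zpart_hom x X : zpart (hom_mx x X) = 1.
Proof. by rewrite /zpart /hom_mx block_mxKul mxE. Qed.

Lemma xpart_hom x X : xpart (hom_mx x X) = x.
Proof. by rewrite /xpart /hom_mx block_mxKdl. Qed.

Lemma Xpart_hom x X : Xpart (hom_mx x X) = X.
Proof. by rewrite /Xpart /hom_mx block_mxKdr. Qed.

Definition part_hom := (zpart_hom, xpart_hom, Xpart_hom).

Lemma hom_mx_eta (Y : 'M[R]_(1 + k)) : psdmx Y -> zpart Y = 1 ->
  Y = hom_mx (xpart Y) (Xpart Y).
Proof.
move=> [/symmetricmxP symY _] zY; rewrite -[LHS]submxK; congr block_mx.
  by apply/matrixP => i j; rewrite !ord1 [in RHS]mxE.
by rewrite /xpart trmx_dlsub symY.
Qed.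

Lemma psdmx_hom_sym x X : psdmx (hom_mx x X) -> X^T = X.
Proof.
by case=> /symmetricmxP; rewrite /hom_mx tr_block_mx => /eq_block_mx[].
Qed.

(** Congruence by [1 0; u N], the homogenization of the affine map x -> u + N x. It serves both the
    lift to slack variables and the projection back. *)
Lemma psdmx_hom_congr (l : nat) (u : 'cV[R]_l) (N : 'M[R]_(l, k)) x X :
  psdmx (hom_mx x X) ->
  psdmx (hom_mx (u + N *m x)
    ((u + N *m x) *m u^T + (u *m x^T + N *m X) *m N^T)).
Proof.
move=> /(psdmx_congr (block_mx 1%:M 0 u N : 'M_(1 + l, 1 + k))).
rewrite /hom_mx tr_block_mx !mulmx_block trmx1 !trmx0 !mul0mx !mulmx0 !mulmx1.
by rewrite !mul1mx !addr0 linearD /= trmx_mul mul1mx.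
Qed.

Lemma psdmx_hom_rank1 x : psdmx (hom_mx x (x *m x^T)).
Proof.
have -> : hom_mx x (x *m x^T) =
    col_mx 1%:M x *m (1%:M : 'M[R]_1) *m (col_mx 1%:M x)^T.
  by rewrite mulmx1 tr_col_mx mul_col_row trmx1 mul1mx mulmx1 mul1mx.
apply: psdmx_congr; split; first by apply/symmetricmxP; rewrite trmx1.
by move=> v; rewrite mulmx1 mxE big_ord1 mxE -expr2 sqr_ge0.
Qed.

Lemma lemx0_hom x X : lemx 0 (hom_mx x X) <-> lemx 0 x /\ lemx 0 X.
Proof.
rewrite lemx0_block; split=> [[] // | [hx hX]]; split=> //; last exact: lemx0_tr.
by apply/lemx0P => i j; rewrite !ord1 mxE.
Qed.

Lemma mxinner_costmx (Q : 'M[R]_k) (c : 'cV[R]_k) x X :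
  mxinner (costmx Q c) (hom_mx x X) = \tr (Q *m X^T) + 2 * (c^T *m x) 0 0.
Proof.
rewrite /mxinner /costmx /hom_mx tr_block_mx mulmx_block mxtrace_block trmx1 trmxK.
rewrite mul0mx add0r linearD /= (mxtrace_mulC c) !trace_mx11.
(* The two off-diagonal blocks contribute equally, whence the factor 2. *)
have -> : (x^T *m c) 0 0 = (c^T *m x) 0 0.
  by rewrite -[x^T *m c]trmxK mxE trmx_mul trmxK.
ring.
Qed.

End HomMx.

(** * Selection of B and the binary reformulations *)

Section Lift.
Variables (R : realType) (m n : nat).
Variables (Q : 'M[R]_n) (c : 'cV[R]_n) (A : 'M[R]_(m, n)) (b : 'cV[R]_m).
Variable B : {set 'I_n}.

Local Notation p := #|B|.
Local Notation G := (selmx R B).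
Local Notation d := (onesv R p).
Implicit Types (x : 'cV[R]_n) (X : 'M[R]_n).

Lemma selmx_mulE (q : nat) (M : 'M[R]_(n, q)) k j :
  (G *m M) k j = M (enum_val k) j.
Proof.
rewrite mxE (bigD1 (enum_val k)) //= mxE eqxx mul1r big1 ?addr0 // => i.
by rewrite eq_sym => /negPf ni; rewrite mxE ni mul0r.
Qed.

(** The roots of t = t^2 are 0 and 1. This form matches the condition x_i = X_ii at X = x x^T. *)
Lemma binaryBP (x : 'cV[R]_n) :
  binaryB B x <-> forall i, i \in B -> x i 0 = x i 0 * x i 0.
Proof.
split=> [H i Bi | H k].
  move: (H (enum_rank_in Bi i)); rewrite selmx_mulE enum_rankK_in //.
  by case=> ->; rewrite ?mulr0 ?mulr1.
rewrite selmx_mulE; have /eqP := H _ (enum_valP k).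
rewrite -subr_eq0 -{1}[x _ _]mulr1 -mulrBr mulf_eq0 subr_eq0.
by case/orP=> /eqP; [left | right].
Qed.

Lemma feasP1_P2 x : feasP1 A b B x -> feasP2 (B := B) A b (x, d - G *m x).
Proof.
case=> Ax xd bx x0; split=> //=; first by rewrite addrC subrK.
by apply/lemx0P => i j; rewrite mxE [X in _ + X]mxE subr_ge0.
Qed.

Lemma feasP2_P1 xs : feasP2 (B := B) A b xs -> feasP1 A b B xs.1.
Proof.
case=> Ax xd bx x0 /lemx0P s0; split=> // i j.
by rewrite -xd [leRHS]mxE lerDl.
Qed.

Lemma feasP2_P3 xs : feasP2 (B := B) A b xs <-> feasP3 (B := B) A b xs.
Proof.
suff H : G *m xs.1 + xs.2 = d ->
    binaryB B xs.1 <-> map2_mx *%R (G *m xs.1) xs.2 = 0.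
  by split=> -[Ax xd h x0 s0]; split=> //; apply/(H xd).
move=> /matrixP xd.
(* With the slack equal to 1 - t, complementarity reads t (1 - t) = 0, that is, t is 0 or 1. *)
have sE k : xs.2 k 0 = 1 - (G *m xs.1) k 0.
  by have := xd k 0; rewrite [LHS]mxE [RHS]mxE => <-; rewrite addrAC subrr add0r.
split=> [h | /matrixP h k].
  apply/matrixP => k j; rewrite !ord1 [LHS]mxE [RHS]mxE sE.
  by case: (h k) => ->; rewrite ?mul0r ?subrr ?mulr0.
have := h k 0; rewrite [LHS]mxE [RHS]mxE sE => /eqP.
by rewrite mulf_eq0 subr_eq0 eq_sym => /orP[] /eqP; [left | right].
Qed.

(** * Lift to the slack variables *)

Definition liftx x : 'cV[R]_(n + p) := col_mx x (d - G *m x).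

(** The blocks expand (x, s) (x, s)^T for s = d - G x, with X written in place of x x^T. *)
Definition liftX x X : 'M[R]_(n + p) :=
  block_mx X (x *m d^T - X *m G^T) (d *m x^T - G *m X) (GRLT B (hom_mx x X)).

Lemma GRLT_hom x X : GRLT B (hom_mx x X) =
  G *m X *m G^T - G *m x *m d^T - d *m x^T *m G^T + d *m d^T.
Proof. by rewrite /GRLT !part_hom scale1r. Qed.

Lemma psdmx_lift x X : psdmx (hom_mx x X) -> psdmx (hom_mx (liftx x) (liftX x X)).
Proof.
(* The lift is affine: (x, d - G x) = u + N x with u = (0, d) and N = [I; -G]. *)
pose u : 'cV[R]_(n + p) := col_mx 0 d.
pose N : 'M[R]_(n + p, n) := col_mx 1%:M (- G).
have xE : liftx x = u + N *m x.
  by rewrite mul_col_mx mul1mx add_col_mx add0r mulNmx.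
suff -> : liftX x X = (u + N *m x) *m u^T + (u *m x^T + N *m X) *m N^T.
  by rewrite xE; apply: psdmx_hom_congr.
rewrite -xE /u /N /liftx /liftX GRLT_hom !tr_col_mx trmx0 trmx1.
rewrite (mul_col_mx _ _ x^T) (mul_col_mx _ _ X) add_col_mx !mul_col_row.
rewrite !mulmx0 mul0mx !mulmx1 mul1mx add_block_mx !add0r linearN /= !mulmxN.
rewrite !mulNmx !mulmxBl.
congr block_mx => //.
by apply/matrixP => i j; rewrite !mxE; ring.
Qed.

Lemma lift_eqs x X : A *m x = b -> A *m X = b *m x^T ->
  liftA A B *m liftx x = liftb b B /\
  liftA A B *m liftX x X = liftb b B *m (liftx x)^T.
Proof.
move=> Ax AX; split.
  rewrite mul_block_col !mul0mx mul1mx addr0 Ax.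
  by rewrite addrCA subrr addr0.
rewrite /liftA /liftX /liftb /liftx GRLT_hom tr_col_mx mul_col_row mulmx_block.
have -> : (d - G *m x)^T = d^T - x^T *m G^T by rewrite linearB /= trmx_mul.
(* The upper blocks now agree by [Ax] and [AX]; in the lower ones the terms containing X cancel. *)
rewrite !mul0mx !mul1mx !addr0 !mulmxBr !mulmxA Ax AX; congr block_mx.
  by rewrite addrCA subrr addr0.
by apply/matrixP => i j; rewrite !mxE; ring.
Qed.

(** The rows [G I] are solved for the slack blocks in turn: first s and the lower left block V, then
    W = V^T by symmetry, and finally S = d s^T - G W. *)
Lemma lift_eqs_inv (x' : 'cV[R]_(n + p)) (X' : 'M[R]_(n + p)) : X'^T = X' ->
  liftA A B *m x' = liftb b B -> liftA A B *m X' = liftb b B *m x'^T ->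
  let x := usubmx x' in let X := ulsubmx X' in
  [/\ x' = liftx x, X' = liftX x X, A *m x = b & A *m X = b *m x^T].
Proof.
rewrite -[x']vsubmxK -[X']submxK.
move: (usubmx x') (dsubmx x') => x s.
move: (ulsubmx X') (ursubmx X') (dlsubmx X') (drsubmx X') => X W V S.
rewrite tr_block_mx tr_col_mx mul_block_col mulmx_block mul_col_row.
rewrite !mul0mx !mul1mx !addr0 col_mxKu block_mxKul.
move=> /eq_block_mx[symX _ trW _] /eq_col_mx[Ax Gx] /eq_block_mx[AX _ GX GW].
have sE : s = d - G *m x by rewrite -Gx addrC addKr.
have VE : V = d *m x^T - G *m X by rewrite -GX addrC addKr.
have WE : W = x *m d^T - X *m G^T.
  by rewrite -[W]trmxK trW VE linearB /= !trmx_mul trmxK symX.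
split=> //; first by rewrite /liftx -sE.
rewrite /liftX -WE -VE; congr block_mx.
have -> : S = d *m s^T - G *m W by rewrite -GW addrC addKr.
rewrite GRLT_hom sE WE linearB /= trmx_mul !mulmxBr !mulmxA.
by apply/matrixP => i j; rewrite !mxE; ring.
Qed.

(** Symmetry of X makes the two off-diagonal blocks of [liftX] transposes of each other, so one RLT
    inequality covers both. *)
Lemma lemx0_lift x X : X^T = X ->
  lemx 0 (hom_mx (liftx x) (liftX x X)) <->
  [/\ lemx 0 (hom_mx x X), lemx 0 (GRLT B (hom_mx x X)),
      lemx 0 (d *m x^T - G *m X) & lemx 0 (d - G *m x)].
Proof.
move=> symX; split.
  move=> /lemx0_hom[/lemx0P h /lemx0_block[hX _ hV hS]]; split=> //.
    apply/lemx0_hom; split=> //; apply/lemx0P => i j.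
    by move: (h (lshift _ i) j); rewrite col_mxEu.
  by apply/lemx0P => i j; move: (h (rshift _ i) j); rewrite col_mxEd.
move=> [/lemx0_hom[/lemx0P hx hX] hS hV /lemx0P hs]; apply/lemx0_hom; split.
  apply/lemx0P => i j; case: (split_ordP i) => {}i ->.
    by rewrite col_mxEu.
  by rewrite col_mxEd.
apply/lemx0_block; split=> //.
rewrite -[x *m _ - _]trmxK; apply: lemx0_tr.
by rewrite linearB /= !trmx_mul !trmxK symX.
Qed.

Lemma mxinner_lift x X :
  mxinner (costmx (liftQ Q B) (liftc c B)) (hom_mx (liftx x) (liftX x X)) =
  mxinner (costmx Q c) (hom_mx x X).
Proof.
rewrite !mxinner_costmx /liftQ /liftc /liftx /liftX tr_block_mx mulmx_block.
rewrite mxtrace_block !mul0mx !addr0 mxtrace0 addr0 tr_col_mx mul_row_col.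
by rewrite trmx0 mul0mx addr0.
Qed.

Lemma liftX_compl x X k :
  liftX x X (lshift p (enum_val k)) (rshift n k) =
  x (enum_val k) 0 - X (enum_val k) (enum_val k).
Proof.
rewrite block_mxEur mxE [X in X + _]mxE big_ord1 [d^T _ _]mxE [d _ _]mxE mulr1.
rewrite [X in _ + X]mxE -[X *m G^T]trmxK trmx_mul trmxK [_^T _ _]mxE.
by rewrite selmx_mulE mxE.
Qed.

(** * Correspondence of feasible sets *)

Lemma feasSDPRLT_DNN x X : feasSDPRLT A b B (hom_mx x X) ->
  feasDNN (B := B) A b (hom_mx (liftx x) (liftX x X)).
Proof.
rewrite /feasSDPRLT /feasDNN /= !part_hom scale1r.
case=> [[psdY Y0 Ax AX] [xX _ S0 V0 s0]].
have [? ?] := lift_eqs Ax AX; have symX := psdmx_hom_sym psdY; split.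
  by split=> //; [exact: psdmx_lift | apply/lemx0_lift].
by split=> // i /xX; rewrite block_mxEul col_mxEu.
Qed.

(** A principal submatrix is a congruence transform, here with u = 0 and N = [I 0]. *)
Lemma psdmx_hom_usub (x' : 'cV[R]_(n + p)) (X' : 'M[R]_(n + p)) :
  psdmx (hom_mx x' X') -> psdmx (hom_mx (usubmx x') (ulsubmx X')).
Proof.
pose N : 'M[R]_(n, n + p) := row_mx 1%:M 0.
have xE : usubmx x' = 0 + N *m x'.
  by rewrite -{2}[x']vsubmxK mul_row_col mul1mx mul0mx addr0 add0r.
suff XE : ulsubmx X' = (0 + N *m x') *m 0^T + (0 *m x'^T + N *m X') *m N^T.
  by rewrite xE XE; apply: psdmx_hom_congr.
rewrite trmx0 mulmx0 mul0mx !add0r -{2}[X']submxK mul_row_block tr_row_mx.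
by rewrite trmx1 trmx0 !mul1mx !mul0mx !addr0 mul_row_col mulmx1 mulmx0 addr0.
Qed.

Lemma feasDNN_SDPRLT (Y : 'M[R]_(1 + (n + p))) : feasDNN (B := B) A b Y ->
  exists x X, Y = hom_mx (liftx x) (liftX x X) /\ feasSDPRLT A b B (hom_mx x X).
Proof.
case=> [[psdY Y0 Ax' AX'] [xX z1]].
have YE := hom_mx_eta psdY z1; rewrite YE in psdY Y0.
have symX' := psdmx_hom_sym psdY; have psdx := psdmx_hom_usub psdY.
have := lift_eqs_inv symX' Ax' AX'; move: psdx.
set x := usubmx _; set X := ulsubmx _ => psdx [xE XE Ax AX].
exists x, X; rewrite -xE -XE; split=> //; rewrite xE XE in Y0 xX.
have [Y00 S0 V0 s0] := (lemx0_lift _ (psdmx_hom_sym psdx)).1 Y0.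
rewrite /feasSDPRLT /= !part_hom scale1r; split=> //; split=> // i /xX.
by rewrite block_mxEul col_mxEu.
Qed.

Lemma feasDNN_COMP (Y : 'M[R]_(1 + (n + p))) :
  feasDNN (B := B) A b Y <-> feasCOMP (B := B) A b Y.
Proof.
(* The shared constraints force Y to be a lift; on lifts both remaining conditions become x_i = X_ii
   for i in B. *)
suff H : [/\ psdmx Y, lemx 0 Y, liftA A B *m xpart Y = liftb b B &
    liftA A B *m Xpart Y = liftb b B *m (xpart Y)^T] -> zpart Y = 1 ->
    (forall i, i \in B ->
      Xpart Y (lshift p i) (lshift p i) = xpart Y (lshift p i) 0) <->
    (forall k : 'I_p, Xpart Y (lshift p (enum_val k)) (rshift n k) = 0).
  by split=> [[h [xX z1]] | [h [z1 xX]]]; split=> //; split=> //; apply/(H h z1).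
move=> [psdY _ Ax' AX'] z1.
have symX' : (Xpart Y)^T = Xpart Y.
  by apply: (@psdmx_hom_sym _ _ (xpart Y)); rewrite -hom_mx_eta.
have [xE XE _ _] := lift_eqs_inv symX' Ax' AX'.
rewrite xE XE; split=> [h k | h i Bi].
  rewrite liftX_compl; apply/eqP; rewrite subr_eq0 eq_sym; apply/eqP.
  by have := h _ (enum_valP k); rewrite block_mxEul col_mxEu.
have := h (enum_rank_in Bi i); rewrite liftX_compl enum_rankK_in //.
by rewrite block_mxEul col_mxEu => /eqP; rewrite subr_eq0 => /eqP.
Qed.

Lemma feasP1_SDPRLT x : feasP1 A b B x ->
  feasSDPRLT A b B (hom_mx x (x *m x^T)).
Proof.
move=> [Ax xd /binaryBP xx x0].
have x0' i : 0 <= x i 0 by move/lemx0P: x0; apply.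
have s0 k : 0 <= (d - G *m x) k 0 by rewrite mxE [X in _ + X]mxE subr_ge0.
rewrite /feasSDPRLT /= !part_hom scale1r; split; split=> //.
- exact: psdmx_hom_rank1.
- apply/lemx0_hom; split=> //; apply/lemx0P => i j.
  by rewrite mxE big_ord1 mxE mulr_ge0.
- by rewrite mulmxA Ax.
- by move=> i /xx; rewrite mxE big_ord1 mxE.
(* At rank one the RLT matrix is s s^T for the nonnegative slack s = d - G x. *)
- have -> : GRLT B (hom_mx x (x *m x^T)) = (d - G *m x) *m (d - G *m x)^T.
    rewrite GRLT_hom linearB /= trmx_mul mulmxBl !mulmxBr !mulmxA.
    by apply/matrixP => i j; rewrite !mxE; ring.
  by apply/lemx0P => i j; rewrite mxE big_ord1 [_^T _ _]mxE mulr_ge0.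
(* Likewise d x^T - G x x^T = s x^T. *)
- rewrite mulmxA -mulmxBl; apply/lemx0P => i j.
  by rewrite mxE big_ord1 [_^T _ _]mxE mulr_ge0.
- by apply/lemx0P => i j; rewrite !ord1.
Qed.

Lemma mxinner_rank1 x :
  mxinner (costmx Q c) (hom_mx x (x *m x^T)) = qobj Q c x.
Proof.
rewrite mxinner_costmx /qobj trmx_mul trmxK mulmxA mxtrace_mulC mulmxA.
by rewrite trace_mx11.
Qed.

End Lift.

(** * Comparison of optimal values *)

Theorem theorem2 (R : realType) (m n : nat) (Q : 'M[R]_n) (c : 'cV[R]_n)
  (A : 'M[R]_(m, n)) (b : 'cV[R]_m) (B : {set 'I_n}) :
  Q \is symmetricmx -> row_free A -> lemx 0 b ->
  [/\ (vSHOR Q c A b B <= vSDPRLT Q c A b B)%E,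
      vSDPRLT Q c A b B = vDNN Q c A b B,
      vDNN Q c A b B = vCOMP Q c A b B &
      (vCOMP Q c A b B <= vP1 Q c A b B)%E] /\
  [/\ vP1 Q c A b B = vP2 Q c A b B & vP2 Q c A b B = vP3 Q c A b B].
Proof.
move=> _ _ _.
have RLT_DNN : vSDPRLT Q c A b B = vDNN Q c A b B.
  apply/eqP; rewrite eq_le; apply/andP; split; apply: optval_le => Y.
    move=> /feasDNN_SDPRLT[x [X [-> FX]]].
    by exists (hom_mx x X); rewrite ?mxinner_lift.
  move=> FY; have [[psdY _ _ _] [_ z1 _ _ _]] := FY.
  (* Symmetry and z = 1 put Y in homogenized form, so that it can be lifted. *)
  move: (hom_mx_eta psdY z1) FY => ->; move: (xpart Y) (Xpart Y) => x X FX.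
  exists (hom_mx (liftx B x) (liftX B x X)); first exact: feasSDPRLT_DNN.
  exact: mxinner_lift.
have DNN_COMP : vDNN Q c A b B = vCOMP Q c A b B.
  apply/eqP; rewrite eq_le.
  by apply/andP; split; apply: optval_le => Y /feasDNN_COMP FY; exists Y.
split; split=> //.
(* The same Y is Shor feasible; x >= 0 is read off from its first column. *)
- apply: optval_le => Y [[psdY Y0 Ax _] [xX z1 _ _ s0]]; exists Y => //.
  split=> //; split=> //; apply/lemx0P => i j; move/lemx0P: Y0 => Y0.
  by rewrite /xpart !mxE.
- rewrite -DNN_COMP -RLT_DNN; apply: optval_le => x /feasP1_SDPRLT Fx.
  by exists (hom_mx x (x *m x^T)); rewrite ?mxinner_rank1.
- apply/eqP; rewrite eq_le; apply/andP; split; apply: optval_le.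
    by move=> xs /feasP2_P1 Fx; exists xs.1.
  by move=> x /feasP1_P2 Fx; exists (x, onesv R #|B| - selmx R B *m x).
- apply/eqP; rewrite eq_le.
  by apply/andP; split; apply: optval_le => xs /feasP2_P3 Fx; exists xs.
Qed.
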